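(* Let $0<q<1$ and $N\ge2$. Gaussian generating functionals $\psi$ on $SU_q(N)$ are parametrized one-to-one by $N-1$ real numbers $r_j$ $(j=2,\dots,N)$ and a positive (semidefinite, symmetric) real $(N-1)\times(N-1)$-matrix $(r_{jk})_{j,k=2,\dots,N}$ as $$\psi=\sum_{j=2}^N r_j\,\varepsilon'_j+\frac12\sum_{j,k=2}^N r_{jk}\,\varepsilon''_{jk}.$$
   Context: Fix $0<q<1$. $SU_q(N)$ is the unital complex algebra generated by $u_{jk}$ $(1\le j,k\le N)$ subject to: $u_{ij}u_{kj}=qu_{kj}u_{ij}$ for $i<k$; $u_{ij}u_{il}=qu_{il}u_{ij}$ for $j<l$; $u_{ij}u_{kl}=u_{kl}u_{ij}$ for $i<k,\ j>l$; $u_{ij}u_{kl}=u_{kl}u_{ij}-(q^{-1}-q)u_{il}u_{kj}$ for $i<k,\ j<l$; and $D=\mathbf 1$, where $D=\sum_{\sigma\in S_N}(-q)^{i(\sigma)}u_{1,\sigma(1)}\cdots u_{N,\sigma(N)}$ and $i(\sigma)$ is the number of inversions of $\sigma$. It is a $*$-algebra with $u_{jk}^*=(-q)^{k-j}D^{jk}$, where $D^{jk}$ is the quantum determinant (same formula, inversions counted with respect to the natural order of the remaining indices) of the matrix $(u_{il})$ with row $j$ and column $k$ removed. One has $\sum_su_{js}u_{ks}^*=\delta_{jk}\mathbf 1=\sum_su_{sj}^*u_{sk}$. The counit is the unital $*$-homomorphism $\varepsilon\colon SU_q(N)\to\mathbb C$, $\varepsilon(u_{jk})=\delta_{jk}$.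 Put $K_n=\mathrm{span}\,(\ker\varepsilon)^n$ (span of all products of $n$ elements of $\ker\varepsilon$). A generating functional is a linear functional $\psi\colon SU_q(N)\to\mathbb C$ that is hermitian ($\psi(b^* )=\overline{\psi(b)}$), satisfies $\psi(\mathbf 1)=0$, and $\psi(b^*b)\ge0$ for all $b\in\ker\varepsilon$. It is gaussian if it vanishes on $K_3$. For $\theta_2,\dots,\theta_N\in\mathbb R$ and $\theta_1=-\sum_{k=2}^N\theta_k$, let $\varepsilon_{\theta_2,\dots,\theta_N}$ be the unital $*$-homomorphism $SU_q(N)\to\mathbb C$ with $u_{kl}\mapsto e^{i\theta_k}\delta_{kl}$. Then $\varepsilon'_j$ and $\varepsilon''_{jk}$ $(2\le j,k\le N)$ denote the pointwise derivatives $\partial\varepsilon_{\theta_2,\dots,\theta_N}/\partial\theta_j$ and $\partial^2\varepsilon_{\theta_2,\dots,\theta_N}/\partial\theta_j\partial\theta_k$ at $\theta_2=\dots=\theta_N=0$. *)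

(* Defs.v *)
From HB Require Import structures.
From mathcomp Require Import all_boot all_order all_algebra all_fingroup.
From mathcomp Require Import generic_quotient complex.
From mathcomp Require Import all_classical all_reals all_analysis.
(* the notations of monalg clash with those of mathcomp-analysis *)
From mathcomp Require Import -(notations) finmap monalg.
Set Implicit Arguments.
Unset Strict Implicit.
Unset Printing Implicit Defensive.
Import Order.TTheory GRing.Theory Num.Theory.
Import numFieldNormedType.Exports.
Local Open Scope ring_scope.
Local Open Scope quotient_scope.
Local Open Scope complex_scope.

Lemma malg_scaleAr (K : comNzRingType) (X : choiceType) (c : K)
    (f g : malg (fmonom X : choiceType) K) : c *: (f * g) = f * (c *: g).
Proof.
have fcE : f * malgC c = fgmul f (malgC c) by reflexivity.
have cfE : malgC c * f = fgmul (malgC c) f by reflexivity.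
have fc : f * malgC c = malgC c * f.
  rewrite fcE fgmulgU cfE fgmulUg.
  by apply: eq_bigr => m _; rewrite mulm1 mul1m mulrC.
rewrite -[LHS]mul_malgC -[c *: g]mul_malgC.
exact: etrans (mulrA _ _ _)
  (etrans (congr1 (fun h => h * g) (esym fc)) (esym (mulrA _ _ _))).
Qed.

(* The free algebra K<X> is the monoid algebra of the free monoid on X. Its
   operations are locked copies of those of malg: unification would otherwise
   unfold the latter, at a prohibitive cost. *)
Definition freeAlg (K : comNzRingType) (X : choiceType) :=
  malg (fmonom X : choiceType) K.
HB.lock Definition freeGen (K : comNzRingType) (X : choiceType) (x : X) :
  freeAlg K X := mkmalgU (fmu x) 1.
HB.lock Definition freeAdd (K : comNzRingType) (X : choiceType)
  (f g : malg (fmonom X : choiceType) K) := f + g.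
HB.lock Definition freeOpp (K : comNzRingType) (X : choiceType)
  (f : malg (fmonom X : choiceType) K) := - f.
HB.lock Definition freeMul (K : comNzRingType) (X : choiceType)
  (f g : malg (fmonom X : choiceType) K) := f * g.
HB.lock Definition freeScale (K : comNzRingType) (X : choiceType) (c : K)
  (f : malg (fmonom X : choiceType) K) := c *: f.

HB.instance Definition _ K X := Choice.on (freeAlg K X).

Section FreeAlgebraTheory.
Context (K : comNzRingType) (X : choiceType).
Local Notation M := (malg (fmonom X : choiceType) K).
Local Notation F := (freeAlg K X).

Fact freeAddA : associative (@freeAdd K X).
Proof. by move=> f g h; rewrite !freeAdd.unlock addrA. Qed.
Fact freeAddC : commutative (@freeAdd K X).
Proof. by move=> f g; rewrite !freeAdd.unlock addrC. Qed.
Fact freeAdd0 : left_id (0 : M) (@freeAdd K X).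
Proof. by move=> f; rewrite !freeAdd.unlock add0r. Qed.
Fact freeAddN : left_inverse (0 : M) (@freeOpp K X) (@freeAdd K X).
Proof. by move=> f; rewrite freeAdd.unlock freeOpp.unlock addNr. Qed.
HB.instance Definition _ :=
  GRing.isZmodule.Build F freeAddA freeAddC freeAdd0 freeAddN.

Fact freeMulA : associative (@freeMul K X).
Proof. by move=> f g h; rewrite !freeMul.unlock mulrA. Qed.
Fact freeMul1l : left_id (1 : M) (@freeMul K X).
Proof. by move=> f; rewrite freeMul.unlock mul1r. Qed.
Fact freeMul1r : right_id (1 : M) (@freeMul K X).
Proof. by move=> f; rewrite freeMul.unlock mulr1. Qed.
Fact freeMulDl : left_distributive (@freeMul K X) (@freeAdd K X).
Proof. by move=> f g h; rewrite freeMul.unlock freeAdd.unlock mulrDl. Qed.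
Fact freeMulDr : right_distributive (@freeMul K X) (@freeAdd K X).
Proof. by move=> f g h; rewrite freeMul.unlock freeAdd.unlock mulrDr. Qed.
Fact free1_neq0 : (1 : M) != 0.
Proof. exact: oner_neq0. Qed.
HB.instance Definition _ := GRing.Zmodule_isNzRing.Build F
  freeMulA freeMul1l freeMul1r freeMulDl freeMulDr free1_neq0.

Fact freeScaleA c d f :
  freeScale c (@freeScale K X d f) = freeScale (c * d) f.
Proof. by rewrite !freeScale.unlock scalerA. Qed.
Fact freeScale1 : left_id 1 (@freeScale K X).
Proof. by move=> f; rewrite freeScale.unlock scale1r. Qed.
Fact freeScaleDr : right_distributive (@freeScale K X) (@freeAdd K X).
Proof. by move=> c f g; rewrite freeScale.unlock freeAdd.unlock scalerDr. Qed.
Fact freeScaleDl f :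
  {morph (@freeScale K X)^~ f : c d / c + d >-> freeAdd c d}.
Proof. by move=> c d /=; rewrite freeScale.unlock freeAdd.unlock scalerDl. Qed.
HB.instance Definition _ := GRing.Zmodule_isLmodule.Build K F
  freeScaleA freeScale1 freeScaleDr freeScaleDl.

Fact freeScaleAl (c : K) (f g : F) : c *: (f * g) = c *: f * g.
Proof.
rewrite /GRing.scale /GRing.mul /= freeScale.unlock freeMul.unlock.
exact: scalerAl.
Qed.
HB.instance Definition _ := GRing.Lmodule_isLalgebra.Build K F freeScaleAl.

Fact freeScaleAr (c : K) (f g : F) : c *: (f * g) = f * (c *: g).
Proof.
rewrite /GRing.scale /GRing.mul /= freeScale.unlock freeMul.unlock.
exact: malg_scaleAr.
Qed.
HB.instance Definition _ := GRing.Lalgebra_isAlgebra.Build K F freeScaleAr.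

End FreeAlgebraTheory.

(* the evaluation morphism x |-> v x; a monomial m coerces to a word in X *)
Definition freeEval (K : comNzRingType) (X : choiceType) (B : algType K)
    (v : X -> B) (f : freeAlg K X) : B :=
  \sum_(m <- msupp f) mcoeff m f *: \prod_(x <- (m : seq X)) v x.

Section FreeEval.
Context (K : comNzRingType) (X : choiceType) (B : algType K) (v : X -> B).
Let h (m : fmonom X) : B := \prod_(x <- (m : seq X)) v x.

Let freeEvalE f : freeEval v f = mmap (in_alg B) h f.
Proof. by apply: eq_bigr => m _; rewrite /= mulr_algl.
Qed.

Let h_morph : mmorphism h.
Proof.
by split=> [m1 m2|]; rewrite /h ?fmM ?big_cat// fm1 big_nil.
Qed.
HB.instance Definition _ := isMultiplicative.Build _ B h h_morph.

Lemma freeEval_is_zmod_morphism : zmod_morphism (freeEval v).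
Proof.
move=> f g; rewrite !freeEvalE -raddfB.
by rewrite /GRing.add /GRing.opp /= freeAdd.unlock freeOpp.unlock.
Qed.
HB.instance Definition _ :=
  GRing.isZmodMorphism.Build (freeAlg K X) B (freeEval v)
    freeEval_is_zmod_morphism.

Lemma freeEval_is_monoid_morphism : monoid_morphism (freeEval v).
Proof.
have [H1 H2] : multiplicative (mmap (in_alg B) h).
  by apply: commr_mmap_is_multiplicative => g m m'; rewrite /GRing.comm /= mulr_algl mulr_algr.
split=> [|f g]; rewrite !freeEvalE; first exact: H2.
by rewrite -H1 /GRing.mul /= freeMul.unlock.
Qed.
HB.instance Definition _ :=
  GRing.isMonoidMorphism.Build (freeAlg K X) B (freeEval v)
    freeEval_is_monoid_morphism.

Lemma freeEval_is_scalable : scalable (freeEval v).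
Proof.
move=> c f; rewrite !freeEvalE {1}/GRing.scale /= freeScale.unlock.
by rewrite mmapZ /= mulr_algl.
Qed.
HB.instance Definition _ :=
  GRing.isScalable.Build K (freeAlg K X) B *:%R (freeEval v)
    freeEval_is_scalable.

Lemma freeEval_gen x : freeEval v (freeGen K x) = v x.
Proof. by rewrite freeEvalE freeGen.unlock mmapU /= scale1r mul1r /h fmU big_seq1. Qed.

Lemma freeEvalM f g : freeEval v (f * g) = freeEval v f * freeEval v g.
Proof. exact: rmorphM. Qed.
Lemma freeEvalB f g : freeEval v (f - g) = freeEval v f - freeEval v g.
Proof. exact: raddfB. Qed.
Lemma freeEvalZ c f : freeEval v (c *: f) = c *: freeEval v f.
Proof. exact: linearZ. Qed.
Lemma freeEval1 : freeEval v 1 = 1.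
Proof. exact: rmorph1. Qed.
Lemma freeEval_sum (I : Type) (r : seq I) (P : pred I) (f : I -> freeAlg K X) :
  freeEval v (\sum_(i <- r | P i) f i) = \sum_(i <- r | P i) freeEval v (f i).
Proof. exact: raddf_sum. Qed.
Lemma freeEval_prod (I : Type) (r : seq I) (P : pred I) (f : I -> freeAlg K X) :
  freeEval v (\prod_(i <- r | P i) f i)
  = \prod_(i <- r | P i) freeEval v (f i).
Proof. exact: rmorph_prod. Qed.

End FreeEval.

Lemma freeEval_id (K : comNzRingType) (X : choiceType) (f : freeAlg K X) :
  freeEval (@freeGen K X) f = f.
Proof.
pose M := malg (fmonom X : choiceType) K.
have sumE (I : Type) (r : seq I) (g : I -> M) :
    \sum_(i <- r) (g i : freeAlg K X) = \sum_(i <- r) g i :> M.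
  elim: r => [|i r IH]; first by rewrite !big_nil.
  rewrite !big_cons IH {1}/GRing.add /= freeAdd.unlock; reflexivity.
have prodE (r : seq X) : \prod_(x <- r) freeGen K x = mkmalgU (FMonom r) 1 :> M.
  elim: r => [|x r IH]; first by rewrite big_nil -fmoneE.
  rewrite big_cons IH /GRing.mul /= freeMul.unlock freeGen.unlock.
  apply: etrans (fgmulUU _ _ _ _) _; rewrite mulr1.
  by congr mkmalgU; rewrite /mul /= fmmulE fmuE.
rewrite /freeEval sumE [RHS](monalgE (f : M)).
apply: eq_bigr => m _; rewrite prodE /GRing.scale /= freeScale.unlock fmK.
apply: etrans (esym (mul_malgC _ _)) _; apply: etrans (fgmulUU _ _ _ _) _.
by rewrite mulr1 mul1m.
Qed.

Section Presented.
Context (K : comNzRingType) (X : choiceType) (relator : freeAlg K X -> Prop).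
Local Notation F := (freeAlg K X).

(* the two-sided ideal generated by the relators *)
Inductive relIdeal : F -> Prop :=
| relIdeal_gen x : relator x -> relIdeal x
| relIdeal0 : relIdeal 0
| relIdealD x y : relIdeal x -> relIdeal y -> relIdeal (x + y)
| relIdealMl (a x : F) : relIdeal x -> relIdeal (a * x)
| relIdealMr (a x : F) : relIdeal x -> relIdeal (x * a).

Lemma relIdealN x : relIdeal x -> relIdeal (- x).
Proof. by move=> Ix; rewrite -mulN1r; apply: relIdealMl. Qed.

Lemma relIdealB x y : relIdeal x -> relIdeal y -> relIdeal (x - y).
Proof. by move=> Ix /relIdealN; apply: relIdealD. Qed.

Definition relCong (x y : F) : bool := `[< relIdeal (x - y) >].

Lemma relCong_equiv : equiv_class_of relCong.
Proof.
split.
- by move=> x; apply/asboolP; rewrite subrr; exact: relIdeal0.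
- by move=> x y; apply/asboolP/asboolP => /relIdealN; rewrite opprB.
- move=> y x z /asboolP xy /asboolP yz; apply/asboolP.
  by rewrite -[x](subrK y) -addrA; exact: relIdealD.
Qed.
Canonical relCong_equivrel := EquivRelPack relCong_equiv.

Definition presented := {eq_quot relCong_equivrel}.
HB.instance Definition _ : EqQuotient F relCong presented :=
  EqQuotient.on presented.
HB.instance Definition _ := Choice.on presented.

Definition toPres (f : F) : presented := \pi_presented f.

Lemma toPresP (f g : F) : toPres f = toPres g <-> relIdeal (f - g).
Proof.
by split=> [/eqmodP/asboolP|I]; last by apply/eqmodP/asboolP.
Qed.

Lemma toPres_repr (a : presented) : toPres (repr a) = a.
Proof. exact: reprK. Qed.

Definition presAdd (a b : presented) := toPres (repr a + repr b).
Definition presOpp (a : presented) := toPres (- repr a).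
Definition presMul (a b : presented) := toPres (repr a * repr b).
Definition presScale (c : K) (a : presented) := toPres (c *: repr a).

Lemma relIdeal_repr (f : F) : relIdeal (repr (toPres f) - f).
Proof. by apply/toPresP; rewrite toPres_repr. Qed.

Lemma presAddE f g : presAdd (toPres f) (toPres g) = toPres (f + g).
Proof.
by apply/toPresP; rewrite opprD addrACA; apply: relIdealD; exact: relIdeal_repr.
Qed.

Lemma presOppE f : presOpp (toPres f) = toPres (- f).
Proof. by apply/toPresP; rewrite -opprD; apply/relIdealN/relIdeal_repr. Qed.

Lemma presMulE f g : presMul (toPres f) (toPres g) = toPres (f * g).
Proof.
apply/toPresP.
rewrite (_ : _ - _ = (repr (toPres f) - f) * repr (toPres g)
                     + f * (repr (toPres g) - g)); last first.
  by rewrite mulrBl mulrBr addrA subrK.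
by apply: relIdealD; [apply: relIdealMr | apply: relIdealMl];
   exact: relIdeal_repr.
Qed.

Lemma presScaleE c f : presScale c (toPres f) = toPres (c *: f).
Proof.
apply/toPresP; rewrite -scalerBr -mulr_algl.
by apply/relIdealMl/relIdeal_repr.
Qed.

Let presE := (presAddE, presOppE, presMulE, presScaleE).

Lemma presW (P : presented -> Prop) :
  (forall f, P (toPres f)) -> forall a, P a.
Proof. by move=> H a; rewrite -(toPres_repr a). Qed.

Fact presAddA : associative presAdd.
Proof. by do 3![elim/presW => ?]; rewrite !presE addrA. Qed.
Fact presAddC : commutative presAdd.
Proof. by do 2![elim/presW => ?]; rewrite !presE addrC. Qed.
Fact presAdd0 : left_id (toPres 0) presAdd.
Proof. by elim/presW => ?; rewrite !presE add0r. Qed.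
Fact presAddN : left_inverse (toPres 0) presOpp presAdd.
Proof. by elim/presW => ?; rewrite !presE addNr. Qed.
HB.instance Definition _ :=
  GRing.isZmodule.Build presented presAddA presAddC presAdd0 presAddN.

Fact presMulA : associative presMul.
Proof. by do 3![elim/presW => ?]; rewrite !presE mulrA. Qed.
Fact presMul1l : left_id (toPres 1) presMul.
Proof. by elim/presW => ?; rewrite !presE mul1r. Qed.
Fact presMul1r : right_id (toPres 1) presMul.
Proof. by elim/presW => ?; rewrite !presE mulr1. Qed.
Fact presMulDl : left_distributive presMul presAdd.
Proof. by do 3![elim/presW => ?]; rewrite !presE mulrDl. Qed.
Fact presMulDr : right_distributive presMul presAdd.
Proof. by do 3![elim/presW => ?]; rewrite !presE mulrDr. Qed.
HB.instance Definition _ := GRing.Zmodule_isPzRing.Build presented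
  presMulA presMul1l presMul1r presMulDl presMulDr.

Fact presScaleA c d (a : presented) :
  presScale c (presScale d a) = presScale (c * d) a.
Proof. by elim/presW: a => ?; rewrite !presE scalerA. Qed.
Fact presScale1 : left_id 1 presScale.
Proof. by elim/presW => ?; rewrite !presE scale1r. Qed.
Fact presScaleDr : right_distributive presScale +%R.
Proof.
by move=> c; do 2![elim/presW => ?]; rewrite /= /GRing.add /= !presE scalerDr.
Qed.
Fact presScaleDl a : {morph presScale^~ a : c d / c + d}.
Proof. by elim/presW: a => ? c d; rewrite /= !presE scalerDl [RHS]presAddE. Qed.
HB.instance Definition _ := GRing.Zmodule_isLmodule.Build K presented
  presScaleA presScale1 presScaleDr presScaleDl.

Lemma presScaleAl (c : K) (a b : presented) : c *: (a * b) = c *: a * b.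
Proof.
by elim/presW: a => f; elim/presW: b => g;
   rewrite /GRing.scale/= /GRing.mul/= !presE scalerAl.
Qed.

Lemma presScaleAr (c : K) (a b : presented) : c *: (a * b) = a * (c *: b).
Proof.
by elim/presW: a => f; elim/presW: b => g;
   rewrite /GRing.scale/= /GRing.mul/= !presE scalerAr.
Qed.

Lemma toPres_is_zmod_morphism : zmod_morphism toPres.
Proof. by move=> f g; rewrite -presAddE -presOppE. Qed.
HB.instance Definition _ :=
  GRing.isZmodMorphism.Build F presented toPres toPres_is_zmod_morphism.

Lemma toPres_is_monoid_morphism : monoid_morphism toPres.
Proof. by split=> [|f g]; [reflexivity | exact/esym/presMulE]. Qed.
HB.instance Definition _ :=
  GRing.isMonoidMorphism.Build F presented toPres toPres_is_monoid_morphism.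

Lemma toPres_is_scalable : scalable toPres.
Proof. by move=> c f; exact/esym/presScaleE. Qed.
HB.instance Definition _ :=
  GRing.isScalable.Build K F presented *:%R toPres toPres_is_scalable.

Definition presGen (x : X) : presented := toPres (freeGen K x).

(* the morphism on the quotient induced by x |-> v x; see presEvalP *)
Definition presEval (B : algType K) (v : X -> B) (a : presented) : B :=
  freeEval v (repr a).

Section PresEval.
Context (B : algType K) (v : X -> B).
Hypothesis v_rel : forall f, relator f -> freeEval v f = 0.

Lemma presEvalP f : presEval v (toPres f) = freeEval v f.
Proof.
apply/eqP; rewrite -subr_eq0 -raddfB /=; apply/eqP.
elim: (relIdeal_repr f) => {f} [f /v_rel //||f g _ f0 _ g0|a f _ f0|a f _ f0].
- exact: raddf0.
- by rewrite raddfD /= f0 g0 addr0.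
- by rewrite rmorphM /= f0 mulr0.
- by rewrite rmorphM /= f0 mul0r.
Qed.

Lemma presEval_gen x : presEval v (presGen x) = v x.
Proof. by rewrite presEvalP freeEval_gen. Qed.

Lemma presEvalD : {morph presEval v : a b / a + b}.
Proof.
by elim/presW=> f; elim/presW=> g; rewrite -raddfD /= !presEvalP raddfD.
Qed.

Lemma presEvalM : {morph presEval v : a b / a * b}.
Proof.
by elim/presW=> f; elim/presW=> g; rewrite -(rmorphM toPres) !presEvalP rmorphM.
Qed.

Lemma presEval1 : presEval v 1 = 1.
Proof. by rewrite -(rmorph1 toPres) presEvalP rmorph1. Qed.

Lemma presEvalZ c : {morph presEval v : a / c *: a}.
Proof. by elim/presW=> f; rewrite -linearZ /= !presEvalP linearZ. Qed.

End PresEval.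

End Presented.

Definition inversions m (s : 'S_m) : nat :=
  #|[set p : 'I_m * 'I_m | (p.1 < p.2)%N && (s p.2 < s p.1)%N]|.

(* \prod over 'I_m is the ordered product: row 0 first *)
Definition qdet (K : comNzRingType) (A : lalgType K) (q : K) m
    (x : 'I_m -> 'I_m -> A) : A :=
  \sum_(s : 'S_m) (- q) ^+ inversions s *: \prod_(i < m) x i (s i).

Section QuantumSL.
Context (K : fieldType) (q : K) (N : nat).
Local Notation F := (freeAlg K ('I_N * 'I_N)%type).
Local Notation w j k := (freeGen K (j, k) : F).

Inductive SUq_relator : F -> Prop :=
| SUq_rel_col (i j k : 'I_N) of (i < k)%N :
    SUq_relator (w i j * w k j - q *: (w k j * w i j))
| SUq_rel_row (i j l : 'I_N) of (j < l)%N :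
    SUq_relator (w i j * w i l - q *: (w i l * w i j))
| SUq_rel_anti (i j k l : 'I_N) of (i < k)%N & (l < j)%N :
    SUq_relator (w i j * w k l - w k l * w i j)
| SUq_rel_diag (i j k l : 'I_N) of (i < k)%N & (j < l)%N :
    SUq_relator (w i j * w k l
                 - (w k l * w i j - (q^-1 - q) *: (w i l * w k j)))
| SUq_rel_det : SUq_relator (qdet q (fun j k => w j k) - 1).

Lemma SUq_relator_eval (z : 'I_N -> K) (ev : F -> K) :
    \prod_i z i = 1 -> (forall j k, ev (w j k) = z j *+ (j == k)) ->
    ev 1 = 1 ->
    (forall f g, ev (f * g) = ev f * ev g) ->
    (forall c f, ev (c *: f) = c * ev f) ->
    (forall f g, ev (f - g) = ev f - ev g) ->
    (forall (I : finType) (g : I -> F), ev (\sum_i g i) = \sum_i ev (g i)) ->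
    (forall (g : 'I_N -> F), ev (\prod_i g i) = \prod_i ev (g i)) ->
  forall f, SUq_relator f -> ev f = 0.
Proof.
move=> z1 evE ev1 evM evZ evB evS evP.
have off (i j k l : 'I_N) : (i < k)%N -> (l <= j)%N ->
    (z i *+ (i == j)) * (z k *+ (k == l)) = 0.
  move=> ik lj; have [ij|ij] := eqVneq i j; last by rewrite mul0r.
  have [kl|kl] := eqVneq k l; last by rewrite mulr0.
  by move: ik; rewrite ij kl ltnNge lj.
move=> f [i j k ik|i j l jl|i j k l ik lj|i j k l ik jl|].
- have P1 := evM (w i j) (w k j); have P2 := evM (w k j) (w i j).
  rewrite evB evZ P1 P2 (evE i j) (evE k j) (off i j k j ik (leqnn j)).
  by rewrite [X in q * X]mulrC (off i j k j ik (leqnn j)) mulr0 subr0.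
- have P1 := evM (w i j) (w i l); have P2 := evM (w i l) (w i j).
  have off' : (z i *+ (i == j)) * (z i *+ (i == l)) = 0.
    have [ij|ij] := eqVneq i j; last by rewrite mul0r.
    have [il|il] := eqVneq i l; last by rewrite mulr0.
    by move: jl; rewrite -ij -il ltnn.
  rewrite evB evZ P1 P2 (evE i j) (evE i l) off'.
  by rewrite [X in q * X]mulrC off' mulr0 subr0.
- have P1 := evM (w i j) (w k l); have P2 := evM (w k l) (w i j).
  by rewrite evB P1 P2 [X in X - _]mulrC subrr.
- have P1 := evM (w i j) (w k l); have P2 := evM (w k l) (w i j).
  have P3 := evM (w i l) (w k j).
  rewrite evB evB evZ P1 P2 P3 (evE i l) (evE k j).
  by rewrite (off i l k j ik (ltnW jl)) mulr0 subr0 [X in X - _]mulrC subrr.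
have inv1 : inversions (1 : 'S_N)%g = 0%N.
  apply/eqP; rewrite cards_eq0; apply/eqP/finset.setP => -[a b].
  by rewrite !inE /= !perm1; case: ltngtP.
rewrite evB ev1 /qdet evS (bigD1 1%g) //= evZ evP inv1 expr0 mul1r.
have -> : \prod_i ev (w i ((1%g : 'S_N) i)) = 1.
  by rewrite (eq_bigr z) // => i _; rewrite perm1 evE eqxx.
rewrite big1 ?addr0 ?subrr// => s s1.
have /existsP[i si] : [exists i, s i != i].
  apply: contraNT s1; rewrite negb_exists => /forallP H.
  by apply/eqP/permP => i; rewrite perm1; apply/eqP; have := H i; rewrite negbK.
by rewrite evZ evP (bigD1 i) //= evE eq_sym (negbTE si) mul0r mulr0.
Qed.

Lemma diagChar_rel (z : 'I_N -> K) : \prod_i z i = 1 ->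
  forall f, SUq_relator f ->
    freeEval (B := K^o) (fun x => z x.1 *+ (x.1 == x.2)) f = 0.
Proof.
pose v (x : 'I_N * 'I_N) : K^o := z x.1 *+ (x.1 == x.2).
move=> z1; apply: (SUq_relator_eval z1).
- by move=> j k; exact: (freeEval_gen v).
- exact: (freeEval1 v).
- exact: (freeEvalM v).
- exact: (freeEvalZ v).
- exact: (freeEvalB v).
- move=> I g; exact: (freeEval_sum v).
- move=> g; exact: (freeEval_prod v).
Qed.

Definition qSL := presented SUq_relator.
HB.instance Definition _ := GRing.PzRing.on qSL.
HB.instance Definition _ := GRing.Lmodule.on qSL.

Definition ugen (j k : 'I_N) : qSL := presGen SUq_relator (j, k).

(* the character u_jk |-> delta_jk z_j, provided that \prod_j z_j = 1 *)
Definition diagChar (z : 'I_N -> K) : qSL -> K :=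
  presEval (B := K^o) (fun x => z x.1 *+ (x.1 == x.2)).

Section DiagChar.
Variable z : 'I_N -> K.
Hypothesis z1 : \prod_i z i = 1.

Lemma diagChar_gen j k : diagChar z (ugen j k) = z j *+ (j == k).
Proof. exact: (presEval_gen (diagChar_rel z1)). Qed.
Lemma diagCharD : {morph diagChar z : a b / a + b}.
Proof. exact: (presEvalD (diagChar_rel z1)). Qed.
Lemma diagCharM : {morph diagChar z : a b / a * b}.
Proof. exact: (presEvalM (diagChar_rel z1)). Qed.
Lemma diagChar1 : diagChar z 1 = 1.
Proof. exact: (presEval1 (diagChar_rel z1)). Qed.
Lemma diagCharZ c a : diagChar z (c *: a) = c * diagChar z a.
Proof. exact: (presEvalZ (diagChar_rel z1)). Qed.

End DiagChar.

Definition counit : qSL -> K := diagChar (fun=> 1).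

Lemma qSL_oner_neq0 : (1 : qSL) != 0.
Proof.
have z1 : \prod_(i < N) (1 : K) = 1 by rewrite big1_eq.
apply/eqP => /(congr1 counit); rewrite /counit (diagChar1 z1).
rewrite -(scale0r (1 : qSL)) (diagCharZ z1) mul0r.
exact/eqP/oner_neq0.
Qed.
HB.instance Definition _ := GRing.PzSemiRing_isNonZero.Build qSL qSL_oner_neq0.
HB.instance Definition _ :=
  GRing.Lmodule_isLalgebra.Build K qSL (@presScaleAl _ _ SUq_relator).
HB.instance Definition _ :=
  GRing.Lalgebra_isAlgebra.Build K qSL (@presScaleAr _ _ SUq_relator).

End QuantumSL.

Section SUq.
Context (R : realType) (q : R) (N : nat).
Local Notation C := (R[i]).
Local Notation F := (freeAlg C ('I_N * 'I_N)%type).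
Local Notation qC := (q%:C : C).

Definition SUq := qSL qC N.
HB.instance Definition _ := GRing.Algebra.on SUq.

(* u_jk^* = (-q)^(k-j) D^jk, with D^jk the quantum minor obtained by deleting
   row j and column k *)
Definition ustar (j k : 'I_N) : SUq :=
  (- qC) ^ (k%:Z - j%:Z) *: qdet qC (fun i l => ugen qC (lift j i) (lift k l)).

(* The antilinear antimultiplicative map on the free algebra sending the
   generator (j, k) to u_jk^*. That it respects the relations is the fact that
   SU_q(N) is a *-algebra; SUq_star is the induced map on the quotient, and by
   SUq_starP it is the only possible involution with these values. *)
Definition free_star (f : F) : SUq :=
  \sum_(m <- msupp f)
     conjc (mcoeff m f) *: \prod_(x <- rev (m : seq _)) ustar x.1 x.2.
Definition SUq_star (a : SUq) : SUq := free_star (repr a).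

Lemma SUq_starP (s : SUq -> SUq) :
    {morph s : a b / a + b} -> (forall c a, s (c *: a) = conjc c *: s a) ->
    (forall a b, s (a * b) = s b * s a) -> s 1 = 1 ->
    (forall j k, s (ugen qC j k) = ustar j k) ->
  SUq_star =1 s.
Proof.
move=> sD sZ sM s1 su a; rewrite -[in RHS](toPres_repr a) /SUq_star.
set f := repr a; have s0 : s 0 = 0.
  by rewrite -(scale0r (0 : SUq)) sZ conjc0 !scale0r.
pose p := @toPres _ _ (@SUq_relator _ qC N).
have tS (I : Type) (r : seq I) (g : I -> F) :
    p (\sum_(i <- r) g i) = \sum_(i <- r) p (g i).
  exact: raddf_sum.
rewrite -[toPres _ _]/(p f) -[in RHS](freeEval_id f) /freeEval tS (big_morph s sD s0).
apply: eq_bigr => m _.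
have -> : p (mcoeff m f *: \prod_(x <- (m : seq _)) freeGen C x)
        = mcoeff m f *: (\prod_(x <- (m : seq _)) (ugen qC x.1 x.2 : SUq)).
  rewrite /p linearZ; congr (_ *: _); rewrite rmorph_prod.
  by apply: eq_bigr => -[].
rewrite sZ; congr (_ *: _).
elim: (m : seq _) => [|x r IH]; first by rewrite !big_nil s1.
by rewrite rev_cons -cats1 big_cat big_seq1 IH big_cons sM su.
Qed.

Definition Kn (n : nat) : set SUq :=
  [set a | exists m (c : 'I_m -> C) (b : 'I_m -> 'I_n -> SUq),
     (forall i j, counit (b i j) = 0)
     /\ a = \sum_i c i *: \prod_(j < n) b i j].

Definition generating_functional (psi : SUq -> C) : Prop :=
  [/\ scalar psi,
      forall b, psi (SUq_star b) = conjc (psi b),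
      psi 1 = 0 &
      forall b, counit b = 0 -> 0 <= psi (SUq_star b * b)].

Definition gaussian (psi : SUq -> C) : Prop :=
  forall b, Kn 3 b -> psi b = 0.

End SUq.

Section EpsTheta.
Context (R : realType) (q : R) (n : nat).
Local Notation C := (R[i]).

(* N = n.+1; row vectors t : 'rV_n hold (theta_2, ..., theta_N), the entry j
   corresponding to the index lift ord0 j of 'I_n.+1 *)
Definition angle (t : 'rV[R]_n) (k : 'I_n.+1) : R :=
  if unlift ord0 k is Some j then t 0 j else - \sum_j t 0 j.

Definition eps_theta (t : 'rV[R]_n) : SUq q n.+1 -> C :=
  diagChar (fun k => cos (angle t k) +i* sin (angle t k)).

Lemma prod_cis (r : seq 'I_n.+1) (a : 'I_n.+1 -> R) :
  \prod_(k <- r) (cos (a k) +i* sin (a k))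
  = cos (\sum_(k <- r) a k) +i* sin (\sum_(k <- r) a k) :> C.
Proof.
elim: r => [|k r IH]; first by rewrite !big_nil cos0 sin0.
by rewrite !big_cons IH cosD sinD; simpc; congr (_ +i* _); rewrite addrC.
Qed.

Lemma eps_theta_gen t j k :
  eps_theta t (ugen _ j k)
  = (cos (angle t j) +i* sin (angle t j)) *+ (j == k).
Proof.
apply: diagChar_gen; rewrite prod_cis big_ord_recl.
have -> : \sum_(i < n) angle t (lift ord0 i) = \sum_i t 0 i.
  by apply: eq_bigr => i _; rewrite /angle liftK.
by rewrite /angle unlift_none addNr cos0 sin0.
Qed.

(* partial derivative of a complex-valued function of n real variables *)
Definition pderiv (j : 'I_n) (f : 'rV[R]_n -> C) (t : 'rV[R]_n) : C :=
  'D_(delta_mx 0 j) (fun s => complex.Re (f s)) t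
  +i* 'D_(delta_mx 0 j) (fun s => complex.Im (f s)) t.

Definition eps_d1 (j : 'I_n) (b : SUq q n.+1) : C :=
  pderiv j (fun t => eps_theta t b) 0.

Definition eps_d2 (j k : 'I_n) (b : SUq q n.+1) : C :=
  pderiv j (pderiv k (fun t => eps_theta t b)) 0.

End EpsTheta.

Definition psdmx (R : realType) n (A : 'M[R]_n) : Prop :=
  A^T = A /\ forall x : 'rV[R]_n, 0 <= (x *m A *m x^T) 0 0.

(* Main.v *)
(* A linear functional vanishing on K_3 and on 1 is determined by its values on
   x_j = u_jj - 1 and x_j x_k (2 <= j, k <= N). Indeed, if psi is such a
   functional and b is in ker eps, then a |-> psi((a - eps(a)) b) is an
   eps-derivation; so is b |-> psi(a (b - eps(b))), and so is psi itself once it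
   vanishes on products of two elements of ker eps. An eps-derivation kills u_jk for
   j <> k by the q-commutation relations with u_jj (as q <> 1), and D = 1 makes
   its values on the u_jj sum to 0; hence it is determined by u_22, ..., u_NN.
   Moreover psi(x_j x_k) is symmetric in j, k. So psi is a complex combination
   of eps'_j and eps''_jk; the *-compatibility of the characters eps_theta
   makes hermitian psi correspond to real coefficients, and positivity to
   psi(b^* b) = sum_jk r_jk conj(eps'_j b) eps'_k b >= 0 on ker eps. *)
Require Import Defs.
From mathcomp Require Import all_boot all_order all_algebra all_fingroup complex.
From mathcomp Require Import all_classical all_reals all_analysis.
From mathcomp Require Import ring lra.
From mathcomp Require Import -(notations) finmap monalg.
Set Implicit Arguments.
Unset Strict Implicit.
Unset Printing Implicit Defensive.
Import Order.TTheory GRing.Theory Num.Theory.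
Import numFieldNormedType.Exports.
Local Open Scope ring_scope.
Local Open Scope classical_set_scope.
Local Open Scope complex_scope.

(** * Permutations; the algebra by generators and relations, and its counit *)

Lemma inversions_perm1 m : inversions (1%g : 'S_m) = 0%N.
Proof.
apply/eqP; rewrite cards_eq0; apply/eqP/finset.setP => -[a b].
by rewrite !inE /= !perm1; case: ltngtP.
Qed.

Lemma perm_neq1 m (s : 'S_m) : s != 1%g -> exists i, s i != i.
Proof.
move=> s1; apply/existsP; apply: contraNT s1.
rewrite negb_exists => /forallP H; apply/eqP/permP => i; rewrite perm1.
by apply/eqP; rewrite -[_ == _]negbK.
Qed.

Section Generators.
Context (K : fieldType) (q : K) (N : nat).
Local Notation A := (qSL q N).
Local Notation u := (ugen q).
Local Notation w j k := (freeGen K ((j, k) : 'I_N * 'I_N)).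
Local Notation pr := (@toPres _ _ (@SUq_relator _ q N)).

Lemma SUq_relatorP f g : SUq_relator q (f - g) -> pr f = pr g.
Proof. by move=> rel; apply/toPresP/relIdeal_gen. Qed.

Lemma ugen_rowE (i j l : 'I_N) : (j < l)%N -> u i j * u i l = q *: (u i l * u i j).
Proof.
move=> jl; have := SUq_relatorP (SUq_rel_row q i jl).
by rewrite linearZ /= !(rmorphM pr).
Qed.

Lemma ugen_diagE (i j k l : 'I_N) : (i < k)%N -> (j < l)%N ->
  u i j * u k l = u k l * u i j - (q^-1 - q) *: (u i l * u k j).
Proof.
move=> ik jl; have H := SUq_relatorP (SUq_rel_diag q ik jl).
by rewrite raddfB /= toPres_is_scalable !(rmorphM pr) in H.
Qed.

Lemma qdet_ugen : qdet q (fun j k : 'I_N => u j k) = 1.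
Proof.
have := SUq_relatorP (SUq_rel_det q N); rewrite (rmorph1 pr) => <-.
rewrite /qdet raddf_sum; apply: eq_bigr => s _.
by rewrite /= toPres_is_scalable (rmorph_prod pr).
Qed.

(** Every element is a linear combination of words in the generators, and a word grows by left
    multiplication with some [u j k]. *)
Lemma qSL_ind (P : A -> Prop) : P 0 -> P 1 ->
    (forall c a b, P a -> P b -> P (c *: a + b)) ->
    (forall j k a, P a -> P (u j k * a)) ->
  forall a, P a.
Proof.
move=> P0 P1 PL PM; elim/presW => f; rewrite -(freeEval_id f).
rewrite /freeEval raddf_sum; elim: (X in \sum_(i <- X) _) => [|m r IH].
  by rewrite big_nil.
rewrite big_cons /= toPres_is_scalable; apply: PL IH; rewrite (rmorph_prod pr).
elim: (m : seq _) => [|[j k] s IH]; first by rewrite big_nil.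
by rewrite big_cons; apply: PM.
Qed.


Let z1 : \prod_(i < N) (1 : K) = 1. Proof. by rewrite big1_eq. Qed.

Lemma counit_gen (j k : 'I_N) : counit (u j k) = (j == k)%:R.
Proof. exact: (diagChar_gen q z1). Qed.
Lemma counitD : {morph @counit K q N : a b / a + b}.
Proof. exact: (diagCharD z1). Qed.
Lemma counitM : {morph @counit K q N : a b / a * b}.
Proof. exact: (diagCharM z1). Qed.
Lemma counit1 : counit (1 : A) = 1.
Proof. exact: (diagChar1 q z1). Qed.
Lemma counitZ c (a : A) : counit (c *: a) = c * counit a.
Proof. exact: (diagCharZ z1). Qed.
Lemma counit0 : counit (0 : A) = 0.
Proof. by rewrite -(scale0r (0 : A)) counitZ mul0r. Qed.
Lemma counitB1 (a : A) : counit (a - (counit a)%:A) = 0.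
Proof. by rewrite -scaleNr counitD counitZ counit1 mulr1 subrr. Qed.

End Generators.

(** * Linear forms, given as plain functions satisfying [scalar] *)

Section LinearForms.
Context (K : fieldType) (A : lmodType K).

Lemma add_linear_form (f g : A -> K) : scalar f -> scalar g -> scalar (fun a => f a + g a).
Proof. by move=> fl gl c a b; rewrite fl gl mulrDr addrACA. Qed.

Lemma scale_linear_form k (f : A -> K) : scalar f -> scalar (fun a => k * f a).
Proof. by move=> fl c a b; rewrite fl mulrDr mulrCA. Qed.

Lemma sum_linear_form I (r : seq I) (f : I -> A -> K) :
  (forall i, scalar (f i)) -> scalar (fun a => \sum_(i <- r) f i a).
Proof.
move=> fl d a b; rewrite mulr_sumr -big_split; apply: eq_bigr => i _ /=.
by rewrite fl.
Qed.

Context (f : A -> K).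
Hypothesis f_lin : scalar f.

Lemma linear_formD : {morph f : a b / a + b}.
Proof. by move=> a b; rewrite -[a]scale1r f_lin mul1r scale1r. Qed.
Lemma linear_form0 : f 0 = 0.
Proof. by apply: (addIr (f 0)); rewrite -linear_formD !add0r. Qed.
Lemma linear_formZ c a : f (c *: a) = c * f a.
Proof. by rewrite -[c *: a]addr0 f_lin linear_form0 addr0. Qed.
Lemma linear_formB : {morph f : a b / a - b}.
Proof. by move=> a b; rewrite -scaleN1r linear_formD linear_formZ mulN1r. Qed.
Lemma linear_form_sum I (r : seq I) (P : pred I) (F : I -> A) :
  f (\sum_(i <- r | P i) F i) = \sum_(i <- r | P i) f (F i).
Proof. exact: (big_morph f linear_formD linear_form0). Qed.

End LinearForms.

(** * Derivations along the counit *)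

Section Derivation.
Context (K : fieldType) (q : K) (n : nat).
Local Notation A := (qSL q n.+1).
Local Notation u := (ugen q).
Hypothesis q1 : q != 1.
Context (D : A -> K).
Hypothesis D_lin : scalar D.
Hypothesis D_leibniz :
  forall a b, D (a * b) = counit a * D b + D a * counit b.

Lemma derivation1 : D 1 = 0.
Proof.
by apply: (addIr (D 1)); rewrite add0r -[in RHS](mulr1 1) D_leibniz counit1 mul1r mulr1.
Qed.

(** [u j k] and [u j j] q-commute, being in the same row. Their counits are 0 and 1, so the Leibniz
    rule leaves [D (u j k)] on one side, q times it on the other, and q differs from 1. *)
Lemma derivation_offdiag j k : j != k -> D (u j k) = 0.
Proof.
move=> jk; have cjk : counit (u j k) = 0 by rewrite counit_gen (negPf jk).
have cjj : counit (u j j) = 1 by rewrite counit_gen eqxx.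
suff H : D (u j k) = q * D (u j k).
  apply/eqP; move/eqP: H; rewrite -subr_eq0 -{1}[D _]mul1r -mulrBl mulf_eq0.
  by rewrite subr_eq0 eq_sym (negPf q1).
have [kj|jk'|/val_inj jk'] := ltngtP j k; last by rewrite jk' eqxx in jk.
- have := congr1 D (ugen_rowE q j kj).
  rewrite (linear_formZ D_lin) !D_leibniz cjk cjj.
  by rewrite !mul1r mulr0 !mul0r mulr1 addr0 add0r.
- have := congr1 D (ugen_rowE q j jk').
  rewrite (linear_formZ D_lin) !D_leibniz cjk cjj.
  by rewrite !mul1r mulr0 !mul0r mulr1 addr0 add0r.
Qed.

Hypothesis D_diag : forall j : 'I_n, D (u (lift ord0 j) (lift ord0 j)) = 0.

Lemma derivation_nonzero_row (j : 'I_n) k : D (u (lift ord0 j) k) = 0.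
Proof.
by have [<-|/derivation_offdiag//] := eqVneq (lift ord0 j) k; apply: D_diag.
Qed.

Lemma derivation_prod0 I (r : seq I) (F : I -> A) :
  (forall i, D (F i) = 0) -> D (\prod_(i <- r) F i) = 0.
Proof.
move=> F0; elim: r => [|i r IH]; first by rewrite big_nil derivation1.
by rewrite big_cons D_leibniz F0 IH mulr0 mul0r addr0.
Qed.

(** Only the factor from row 0 can be differentiated, as [D] kills all other rows. A permutation
    other than 1 either moves 0, and then [D] kills this off-diagonal factor, or fixes 0 and moves a
    later index, and then the counit kills the remaining product. *)
Lemma derivation_qdet : D (qdet q (fun j k : 'I_n.+1 => u j k)) = D (u ord0 ord0).
Proof.
rewrite /qdet (linear_form_sum D_lin) (bigD1 1%g) //= [X in _ + X]big1 ?addr0 => [|s s1].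
  rewrite (linear_formZ D_lin) inversions_perm1 expr0 mul1r big_ord_recl D_leibniz.
  rewrite derivation_prod0 => [|i]; last exact: derivation_nonzero_row.
  rewrite mulr0 add0r perm1 (big_morph _ (@counitM _ _ _) (@counit1 _ _ _)).
  by rewrite big1 ?mulr1// => i _; rewrite perm1 counit_gen eqxx.
rewrite (linear_formZ D_lin) big_ord_recl D_leibniz.
rewrite derivation_prod0 => [|i]; last exact: derivation_nonzero_row.
rewrite mulr0 add0r; have [s0|s0] := eqVneq ord0 (s ord0); last first.
  by rewrite derivation_offdiag// mul0r mulr0.
have [i si] := perm_neq1 s1.
have [j ij|i0] := unliftP ord0 i; last by rewrite i0 -s0 eqxx in si.
rewrite (big_morph _ (@counitM _ _ _) (@counit1 _ _ _)) (bigD1 j) //= -ij.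
by rewrite counit_gen eq_sym (negPf si) mul0r !mulr0.
Qed.

(* The off-diagonal generators are killed by the q-commutation relations with
   the diagonal ones, and u_11 by the relation D = 1. *)
Lemma derivation_eq0 a : D a = 0.
Proof.
have D00 : D (u ord0 ord0) = 0.
  by rewrite -derivation_qdet qdet_ugen derivation1.
have D0 j k : D (u j k) = 0.
  have [<-|/derivation_offdiag//] := eqVneq j k.
  by have [i ->|->] := unliftP ord0 j.
elim/qSL_ind: a => [||c a b Da Db|j k a Da].
- exact: linear_form0.
- exact: derivation1.
- by rewrite D_lin Da Db mulr0 addr0.
- by rewrite D_leibniz D0 Da mulr0 mul0r addr0.
Qed.

End Derivation.

(** * Functionals that vanish on products of three elements of ker eps *)

Section GaussianFunctional.
Context (K : fieldType) (q : K) (n : nat).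
Local Notation A := (qSL q n.+1).
Local Notation u := (ugen q).
Local Notation x j := (u (lift ord0 j) (lift ord0 j) - 1).
Hypothesis q1 : q != 1.

(** The projection onto ker eps along the unit. *)
Definition augment (a : A) : A := a - (counit a)%:A.

(** Source of all Leibniz rules below: after multiplication by a further element of ker eps the
    first summand is a triple product, which [psi] kills, and the bracket has the shape of an
    eps-derivation. *)
Lemma augmentM a b : augment (a * b)
  = augment a * augment b + (counit a *: augment b + counit b *: augment a).
Proof.
rewrite /augment counitM mulrBl !mulrBr !mulr_algl mulr_algr !scalerBr.
rewrite !scalerA [counit b * counit a]mulrC.
set m := a * b; set s := counit b *: a; set t := counit a *: b.
set e := _%:A.
by rewrite addrA subrK addrA subrK.
Qed.

Lemma counit_augment a : counit (augment a) = 0.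
Proof. exact: counitB1. Qed.

Lemma augmentD c a b : augment (c *: a + b) = c *: augment a + augment b.
Proof.
rewrite /augment counitD counitZ scalerBr addrACA -opprD.
by rewrite scalerA scalerDl.
Qed.

Lemma counit_x (j : 'I_n) : counit (x j : A) = 0.
Proof.
have := counit_augment (u (lift ord0 j) (lift ord0 j)).
by rewrite /augment counit_gen eqxx scale1r.
Qed.

Lemma augment_gen (j : 'I_n) : augment (u (lift ord0 j) (lift ord0 j)) = x j.
Proof. by rewrite /augment counit_gen eqxx scale1r. Qed.

Context (psi : A -> K).
Hypothesis psi_lin : scalar psi.
Hypothesis psi_K3 : forall a b c,
  counit a = 0 -> counit b = 0 -> counit c = 0 -> psi (a * b * c) = 0.

Lemma gaussian_left_lin b : scalar (fun a => psi (augment a * b)).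
Proof. by move=> c a a'; rewrite augmentD mulrDl -scalerAl psi_lin. Qed.

Lemma gaussian_right_lin a : scalar (fun b => psi (a * augment b)).
Proof. by move=> c b b'; rewrite augmentD mulrDr -scalerAr psi_lin. Qed.

Lemma gaussian_leftM b : counit b = 0 -> forall a a',
  psi (augment (a * a') * b)
  = counit a * psi (augment a' * b) + psi (augment a * b) * counit a'.
Proof.
move=> b0 a a'; rewrite augmentM mulrDl (mulrDl (_ *: _)) -!scalerAl 2!(linear_formD psi_lin).
by rewrite psi_K3 ?counit_augment// add0r !(linear_formZ psi_lin) [counit a' * _]mulrC.
Qed.

Lemma gaussian_rightM a : counit a = 0 -> forall b b',
  psi (a * augment (b * b'))
  = counit b * psi (a * augment b') + psi (a * augment b) * counit b'.
Proof.
move=> a0 b b'; rewrite augmentM mulrDr (mulrDr _ (_ *: _)) -!scalerAr 2!(linear_formD psi_lin) mulrA.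
by rewrite psi_K3 ?counit_augment// add0r !(linear_formZ psi_lin) [counit b' * _]mulrC.
Qed.

(** For i < l the diagonal relation says that u_ii and u_ll commute up to a multiple of u_il u_li.
    The functional a |-> psi (augment a * u_li) is an eps-derivation, so it kills the off-diagonal
    u_il, and the correction term disappears. *)
Lemma gaussian_symmetric j k : psi (x j * x k) = psi (x k * x j).
Proof.
suff sym (i l : 'I_n) : (i < l)%N -> psi (x i * x l) = psi (x l * x i).
  by have [jk|kj|/val_inj ->//] := ltngtP j k; [|apply/esym]; apply: sym.
move=> il; have il' : (lift ord0 i < lift ord0 l)%N by rewrite !lift0.
have ne : lift ord0 i != lift ord0 l by rewrite neq_ltn il'.
have off : psi (u (lift ord0 i) (lift ord0 l) * u (lift ord0 l) (lift ord0 i)) = 0.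
  have c0 : counit (u (lift ord0 l) (lift ord0 i)) = 0.
    by rewrite counit_gen eq_sym (negPf ne).
  have := derivation_offdiag q1 (gaussian_left_lin _) (gaussian_leftM c0) ne.
  by rewrite /augment counit_gen (negPf ne) scale0r subr0.
have := congr1 psi (ugen_diagE q il' il').
rewrite (linear_formB psi_lin) (linear_formZ psi_lin) off mulr0 subr0 => E.
rewrite !mulrBl !mulrBr !mulr1 !mul1r !(linear_formB psi_lin) E.
by rewrite !opprB addrACA [RHS]addrACA; congr (_ + _); rewrite addrC.
Qed.

Hypothesis psi1 : psi 1 = 0.
Hypothesis psi_x : forall j, psi (x j) = 0.
Hypothesis psi_xx : forall j k, psi (x j * x k) = 0.

(** [derivation_eq0] is applied three times: in the left factor against each x_k, then in the right
    factor, where the first result supplies the values on the diagonal, and last to [psi], where the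
    second result supplies the Leibniz rule. *)
Lemma gaussian_eq0 a : psi a = 0.
Proof.
have psi_ax a' k : psi (augment a' * x k) = 0.
  apply: (derivation_eq0 q1 (gaussian_left_lin _) (gaussian_leftM (counit_x k))).
  by move=> j; rewrite augment_gen psi_xx.
have psi_ab a' b : psi (augment a' * augment b) = 0.
  apply: (derivation_eq0 q1 (gaussian_right_lin _)
            (gaussian_rightM (counit_augment a'))).
  by move=> j; rewrite augment_gen psi_ax.
have psi_aug b : psi (augment b) = psi b.
  by rewrite (linear_formB psi_lin) (linear_formZ psi_lin) psi1 mulr0 subr0.
apply: (derivation_eq0 q1 psi_lin) => [b c|j]; last first.
  by rewrite -psi_aug augment_gen psi_x.
rewrite -psi_aug augmentM 2!(linear_formD psi_lin) psi_ab add0r !(linear_formZ psi_lin).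
by rewrite !psi_aug [counit c * _]mulrC.
Qed.

End GaussianFunctional.

(** * Differentiation of finite trigonometric sums *)

(** The two difference quotients coincide. This reduces directional derivatives to one real
    variable, where the chain rule is at hand. *)
Lemma is_derive_line (R : realType) (V : normedModType R) (f : V -> R) (t v : V) df :
  is_derive (0 : R) 1 (fun h : R => f (h *: v + t)) df -> is_derive t v f df.
Proof.
have E : (fun h : R => h^-1 *: ((f \o shift t) (h *: v) - f t))
       = (fun h : R => h^-1 *: (((fun k : R => f (k *: v + t)) \o shift 0) (h *: 1)
                         - (fun k : R => f (k *: v + t)) 0)).
  by apply/funext => h /=; rewrite addr0 scale0r add0r /GRing.scale /= mulr1.
by case=> df1 df2; split; [rewrite /derivable E | rewrite /derive E].
Qed.

Section TrigSum.
Context (R : realType) (n : nat).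
Local Notation C := (R[i]).

Definition cis (x : R) : C := cos x +i* sin x.

Lemma cis0 : cis 0 = 1. Proof. by rewrite /cis cos0 sin0. Qed.
Lemma cisD : {morph cis : x y / x + y >-> x * y}.
Proof.
by move=> x y; rewrite /cis cosD sinD; simpc; congr (_ +i* _); rewrite addrC.
Qed.
Lemma conjc_cis x : conjc (cis x) = cis (- x).
Proof. by rewrite /cis cosN sinN. Qed.

Definition pairing (m t : 'rV[R]_n) : R := \sum_j m 0 j * t 0 j.

Lemma pairingD m l t : pairing (m + l) t = pairing m t + pairing l t.
Proof. by rewrite -big_split; apply: eq_bigr => j _; rewrite mxE mulrDl. Qed.
Lemma pairingN m t : pairing (- m) t = - pairing m t.
Proof. by rewrite -sumrN; apply: eq_bigr => j _; rewrite mxE mulNr. Qed.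
Lemma pairing0 m : pairing m 0 = 0.
Proof. by apply: big1 => j _; rewrite mxE mulr0. Qed.
Lemma pairing0l t : pairing 0 t = 0.
Proof. by apply: big1 => j _; rewrite mxE mul0r. Qed.
Lemma pairing_line m t j h :
  pairing m (h *: delta_mx 0 j + t) = m 0 j * h + pairing m t.
Proof.
rewrite /pairing (eq_bigr (fun k => m 0 k * (h *+ (k == j)) + m 0 k * t 0 k)).
  rewrite big_split /=; congr (_ + _); rewrite (bigD1 j) //= eqxx big1 ?addr0//.
  by move=> k /negPf->; rewrite mulr0.
by move=> k _; rewrite !mxE mulrDr eqxx /= mulr_natr.
Qed.

(* [s] lists the pairs (coefficient, frequency vector). *)
Definition trig (s : seq (C * 'rV[R]_n)) (t : 'rV[R]_n) : C :=
  \sum_(p <- s) p.1 * cis (pairing p.2 t).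

(** The derivative in t_j multiplies the coefficient of exp(i<m,t>) by i m_j and keeps the frequency
    m. *)
Definition trig_deriv (j : 'I_n) (s : seq (C * 'rV[R]_n)) :=
  [seq (p.1 * (0 +i* (p.2 : 'rV[R]_n) 0 j), p.2) | p <- s].

Lemma is_derive_Re_cis_line (c : C) (a b : R) :
  is_derive (0 : R) 1 (fun h => complex.Re (c * cis (a * h + b)))
    (complex.Re (c * (0 +i* a) * cis b)).
Proof.
pose l (h : R) : R := a * h + b.
have dl : is_derive (0 : R) 1 l a.
  rewrite [l](_ : _ = a *: (id : R -> R) + cst b) //.
  by apply: is_derive_eq; rewrite addr0 /GRing.scale /= mulr1.
have l0 : l 0 = b by rewrite /l mulr0 add0r.
have dcos : is_derive (0 : R) 1 (cos \o l) (- sin b * a).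
  by apply: is_derive1_comp; rewrite l0; exact: is_derive_cos.
have dsin : is_derive (0 : R) 1 (sin \o l) (cos b * a).
  by apply: is_derive1_comp; rewrite l0; exact: is_derive_sin.
case: c => c d.
rewrite [X in is_derive _ _ X](_ : _ = c *: (cos \o l) - d *: (sin \o l)) //.
by apply: is_derive_eq; rewrite /GRing.scale /= /cis; simpc => /=; ring.
Qed.

(** Im z = Re (-i z), so the claim is the previous one with coefficient -i c. *)
Lemma is_derive_Im_cis_line (c : C) (a b : R) :
  is_derive (0 : R) 1 (fun h => complex.Im (c * cis (a * h + b)))
    (complex.Im (c * (0 +i* a) * cis b)).
Proof.
have ImRe (z : C) : complex.Im z = complex.Re ((0 -i* 1) * z).
  by case: z => x y; simpc.
rewrite ImRe !mulrA; under eq_fun do rewrite ImRe mulrA.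
exact: is_derive_Re_cis_line.
Qed.

Lemma is_derive_trig s (j : 'I_n) (t : 'rV[R]_n) :
  is_derive t (delta_mx 0 j) (fun t => complex.Re (trig s t))
    (complex.Re (trig (trig_deriv j s) t)) /\
  is_derive t (delta_mx 0 j) (fun t => complex.Im (trig s t))
    (complex.Im (trig (trig_deriv j s) t)).
Proof.
have ReD (x y : C) : complex.Re (x + y) = complex.Re x + complex.Re y.
  by case: x y => ? ? [].
have ImD (x y : C) : complex.Im (x + y) = complex.Im x + complex.Im y.
  by case: x y => ? ? [].
rewrite /trig /trig_deriv big_map; elim: s => [|[c m] s [IHr IHi]].
  split; rewrite big_nil /=.
    by rewrite [X in is_derive _ _ X](_ : _ = cst 0);
      [exact: is_derive_cst | apply/funext => h; rewrite big_nil].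
  by rewrite [X in is_derive _ _ X](_ : _ = cst 0);
    [exact: is_derive_cst | apply/funext => h; rewrite big_nil].
rewrite big_cons /= ReD ImD; split.
- rewrite [X in is_derive _ _ X](_ : _ = (fun t => complex.Re (c * cis (pairing m t)))
    + (fun t => complex.Re (\sum_(p <- s) p.1 * cis (pairing p.2 t)))); last first.
    by apply/funext => h; rewrite big_cons ReD.
  apply: is_deriveD IHr; apply: is_derive_line.
  under eq_fun do rewrite pairing_line.
  exact: is_derive_Re_cis_line.
- rewrite [X in is_derive _ _ X](_ : _ = (fun t => complex.Im (c * cis (pairing m t)))
    + (fun t => complex.Im (\sum_(p <- s) p.1 * cis (pairing p.2 t)))); last first.
    by apply/funext => h; rewrite big_cons ImD.
  apply: is_deriveD IHi; apply: is_derive_line.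
  under eq_fun do rewrite pairing_line.
  exact: is_derive_Im_cis_line.
Qed.

(** An equality of functions rather than of values at 0, so that it can be iterated for second
    derivatives. *)
Lemma pderiv_trig j s : pderiv j (trig s) = trig (trig_deriv j s).
Proof.
apply/funext => t; have [dr di] := is_derive_trig s j t.
by rewrite /pderiv !derive_val; case: (trig _ t).
Qed.

Lemma trig0 s : trig s 0 = \sum_(p <- s) p.1.
Proof. by apply: eq_bigr => p _; rewrite pairing0 cis0 mulr1. Qed.

Lemma trig_cat s s' t : trig (s ++ s') t = trig s t + trig s' t.
Proof. exact: big_cat. Qed.

Lemma trig_scale c s t : trig [seq (c * p.1, p.2) | p <- s] t = c * trig s t.
Proof. by rewrite /trig big_map mulr_sumr; apply: eq_bigr => p _; rewrite mulrA. Qed.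

Definition trig_mul (s s' : seq (C * 'rV[R]_n)) :=
  [seq (x.1 * y.1, x.2 + y.2) | x <- s, y <- s'].

Lemma trig_mulE s s' t : trig (trig_mul s s') t = trig s t * trig s' t.
Proof.
rewrite /trig big_allpairs_dep mulr_suml; apply: eq_bigr => x _.
rewrite mulr_sumr; apply: eq_bigr => y _ /=.
by rewrite pairingD cisD mulrACA.
Qed.

Definition trig_conj (s : seq (C * 'rV[R]_n)) :=
  [seq (conjc p.1, - p.2) | p <- s].

Lemma trig_conjE s t : trig (trig_conj s) t = conjc (trig s t).
Proof.
rewrite /trig big_map rmorph_sum; apply: eq_bigr => p _ /=.
by rewrite pairingN -conjc_cis rmorphM.
Qed.

End TrigSum.

(** * The characters eps_theta, their compatibility with the involution, and their derivatives at
    0 *)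

Section Characters.
Context (R : realType) (q : R) (n : nat).
Local Notation C := (R[i]).
Local Notation A := (SUq q n.+1).
Local Notation qC := (q%:C : C).
Local Notation u := (ugen qC).

Lemma prod_cis_angle (t : 'rV[R]_n) : \prod_k cis (angle t k) = 1 :> C.
Proof.
rewrite [LHS]prod_cis big_ord_recl.
have -> : \sum_(i < n) angle t (lift ord0 i) = \sum_i t 0 i.
  by apply: eq_bigr => i _; rewrite /angle liftK.
by rewrite /angle unlift_none addNr cos0 sin0.
Qed.

Lemma eps_thetaD (t : 'rV[R]_n) : {morph @eps_theta R q n t : a b / a + b}.
Proof. exact: (diagCharD (prod_cis_angle t)). Qed.
Lemma eps_thetaM (t : 'rV[R]_n) : {morph @eps_theta R q n t : a b / a * b}.
Proof. exact: (diagCharM (prod_cis_angle t)). Qed.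
Lemma eps_theta1 (t : 'rV[R]_n) : eps_theta t (1 : A) = 1.
Proof. exact: (diagChar1 _ (prod_cis_angle t)). Qed.
Lemma eps_thetaZ (t : 'rV[R]_n) c (a : A) :
  eps_theta t (c *: a) = c * eps_theta t a.
Proof. exact: (diagCharZ (prod_cis_angle t)). Qed.
Lemma eps_theta_zero (t : 'rV[R]_n) : eps_theta t (0 : A) = 0.
Proof. by rewrite -(scale0r (0 : A)) eps_thetaZ mul0r. Qed.

Lemma eps_theta_at0 (a : A) : eps_theta 0 a = counit a.
Proof.
rewrite /eps_theta /counit; congr (diagChar _ a); apply/funext => k.
rewrite (_ : angle 0 k = 0); first exact: cis0.
rewrite /angle; case: unliftP => [j _|_]; rewrite ?mxE//.
by rewrite big1 ?oppr0// => j _; rewrite mxE.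
Qed.

(** If j differs from k, each term of the minor has a factor from row k, whose only entry with
    nonzero value lies in the deleted column k. If j = k, only the identity permutation contributes,
    giving the product of exp(i theta_l) over l other than j; as the angles sum to 0 this is exp(-i
    theta_j). *)
Lemma eps_theta_ustar (t : 'rV[R]_n) (j k : 'I_n.+1) :
  eps_theta t (ustar q j k) = conjc (eps_theta t (u j k)).
Proof.
rewrite eps_theta_gen /ustar eps_thetaZ /qdet.
rewrite (big_morph _ (eps_thetaD t) (eps_theta_zero t)).
have termE (s : 'S_n) : eps_theta t ((- qC) ^+ inversions s *:
      \prod_(i < n) (u (lift j i) (lift k (s i)) : A))
    = (- qC) ^+ inversions s * \prod_(i < n)
      (cis (angle t (lift j i)) *+ (lift j i == lift k (s i))).
  rewrite eps_thetaZ (big_morph _ (eps_thetaM t) (eps_theta1 t)).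
  by congr (_ * _); apply: eq_bigr => i _; rewrite eps_theta_gen.
rewrite (eq_bigr _ (fun s _ => termE s)) {termE}.
have [<-|jk] := eqVneq j k; last first.
  rewrite mulr0n conjc0 big1 ?mulr0// => s _.
  have [i ki|kj] := unliftP j k; last by rewrite kj eqxx in jk.
  by rewrite (bigD1 i) //= -ki (negPf (neq_lift k (s i))) mul0r mulr0.
rewrite subrr expr0z mul1r (bigD1 1%g) //= [X in _ + X]big1 => [|s s1]; last first.
  have [i si] := perm_neq1 s1; rewrite (bigD1 i) //=.
  by rewrite (inj_eq lift_inj) eq_sym (negPf si) mul0r mulr0.
rewrite inversions_perm1 expr0 mul1r addr0 -[RHS]/(conjc (cis _)) conjc_cis.
under eq_bigr do rewrite perm1 eqxx mulr1n.
have := prod_cis_angle t; rewrite (bigD1_ord j) //= => /(congr1 ( *%R (cis (- angle t j)))).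
by rewrite mulrA -cisD addNr cis0 mul1r mulr1 => ->.
Qed.

(** The involution reverses words and conjugates coefficients. Under a character with values in the
    commutative C the reversal disappears, and each letter is handled by [eps_theta_ustar]. *)
Lemma eps_theta_star (t : 'rV[R]_n) (a : A) :
  eps_theta t (SUq_star a) = conjc (eps_theta t a).
Proof.
rewrite /SUq_star /free_star (big_morph _ (eps_thetaD t) (eps_theta_zero t)).
(* The right-hand side is expanded over the words of the same representative of [a] that defines
   [SUq_star a]. *)
rewrite [X in conjc X](_ : _ = \sum_(m <- msupp (generic_quotient.repr a))
   mcoeff m (generic_quotient.repr a) *
    \prod_(x <- (m : seq _)) eps_theta t (u x.1 x.2)); last first.
  rewrite /eps_theta /diagChar /presEval /freeEval; apply: eq_bigr => m _.
  by congr (_ * _); apply: eq_bigr => x _; rewrite -[RHS]/(eps_theta t _) eps_theta_gen.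
rewrite rmorph_sum; apply: eq_bigr => m _.
rewrite eps_thetaZ rmorphM; congr (_ * _).
rewrite (big_morph _ (eps_thetaM t) (eps_theta1 t)) rmorph_prod.
elim: (m : seq _) => [|x s IH]; first by rewrite !big_nil.
rewrite rev_cons -cats1 big_cat big_seq1 big_cons /= mulrC IH.
by rewrite eps_theta_ustar.
Qed.

(** The frequency of exp(i theta_k): a coordinate vector, or (-1, ..., -1) for the first index
    because theta_1 is minus the sum of the others. *)
Definition weight (k : 'I_n.+1) : 'rV[R]_n :=
  \row_j (if unlift ord0 k is Some i then (i == j)%:R else -1).

Lemma pairing_weight k t : pairing (weight k) t = angle t k.
Proof.
rewrite /pairing /angle; under eq_bigr do rewrite mxE.
case: unliftP => [i _|_]; last by rewrite -sumrN; apply: eq_bigr => j _; rewrite mulN1r.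
rewrite (bigD1 i) //= eqxx mul1r big1 ?addr0// => j; rewrite eq_sym => /negPf->.
by rewrite mul0r.
Qed.

(** Writes theta |-> eps_theta(a) as a trigonometric sum; the counit and all derivatives at 0 can
    then be read off the list [s]. *)
Definition expansion (a : A) (s : seq (C * 'rV[R]_n)) :=
  forall t, eps_theta t a = trig s t.

Lemma expansion_gen j k : expansion (u j k) [:: ((j == k)%:R, weight j)].
Proof. by move=> t; rewrite eps_theta_gen /trig big_seq1 pairing_weight mulr_natl. Qed.

Lemma expansion1 : expansion 1 [:: (1, 0)].
Proof. by move=> t; rewrite eps_theta1 /trig big_seq1 pairing0l cis0 mulr1. Qed.

Lemma expansionM a b s s' : expansion a s -> expansion b s' ->
  expansion (a * b) (trig_mul s s').
Proof. by move=> As Bs t; rewrite eps_thetaM As Bs trig_mulE. Qed.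

Lemma expansion_lin c a b s s' : expansion a s -> expansion b s' ->
  expansion (c *: a + b) ([seq (c * p.1, p.2) | p <- s] ++ s').
Proof. by move=> As Bs t; rewrite eps_thetaD eps_thetaZ As Bs trig_cat trig_scale. Qed.

Lemma expansion_star a s : expansion a s -> expansion (SUq_star a) (trig_conj s).
Proof. by move=> As t; rewrite eps_theta_star As trig_conjE. Qed.

(** Generators have one-term expansions, and trigonometric sums are closed under linear combinations
    and products. *)
Lemma expansion_exists a : exists s, expansion a s.
Proof.
elim/qSL_ind: a => [||c a b [s As] [s' Bs]|j k a [s As]].
- by exists [::] => t; rewrite eps_theta_zero /trig big_nil.
- by exists [:: (1, 0)]; exact: expansion1.
- by exists ([seq (c * p.1, p.2) | p <- s] ++ s'); exact: expansion_lin.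
- by exists (trig_mul [:: ((j == k)%:R, weight j)] s); apply: expansionM As;
    exact: expansion_gen.
Qed.

Lemma expansion_counit a s : expansion a s -> counit a = \sum_(p <- s) p.1.
Proof. by move=> As; rewrite -eps_theta_at0 As trig0. Qed.

Lemma expansion_d1 j a s : expansion a s ->
  eps_d1 j a = \sum_(p <- s) p.1 * (0 +i* (p.2 : 'rV_n) 0 j).
Proof.
by move=> As; rewrite /eps_d1 (funext As) pderiv_trig trig0 big_map.
Qed.

Lemma expansion_d2 j k a s : expansion a s ->
  eps_d2 j k a = \sum_(p <- s)
    p.1 * ((0 +i* (p.2 : 'rV_n) 0 j) * (0 +i* (p.2 : 'rV_n) 0 k)).
Proof.
move=> As; rewrite /eps_d2 (funext As) !pderiv_trig trig0 !big_map.
by apply: eq_bigr => p _; rewrite /= -mulrA [X in _ * X]mulrC.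
Qed.

Lemma eps_d1_lin j : scalar (@eps_d1 R q n j).
Proof.
move=> c a b; have [s As] := expansion_exists a; have [s' Bs] := expansion_exists b.
rewrite (expansion_d1 j (expansion_lin c As Bs)) (expansion_d1 j As) (expansion_d1 j Bs).
rewrite big_cat big_map mulr_sumr; congr (_ + _); apply: eq_bigr => p _ /=.
by rewrite mulrA.
Qed.

Lemma eps_d2_lin j k : scalar (@eps_d2 R q n j k).
Proof.
move=> c a b; have [s As] := expansion_exists a; have [s' Bs] := expansion_exists b.
rewrite (expansion_d2 j k (expansion_lin c As Bs)).
rewrite (expansion_d2 j k As) (expansion_d2 j k Bs).
rewrite big_cat big_map mulr_sumr; congr (_ + _); apply: eq_bigr => p _ /=.
by rewrite -mulrA.
Qed.

Lemma eps_d1_unit j : eps_d1 j (1 : A) = 0.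
Proof. by rewrite (expansion_d1 j expansion1) big_seq1 mxE mulr0. Qed.

Lemma eps_d2_unit j k : eps_d2 j k (1 : A) = 0.
Proof. by rewrite (expansion_d2 j k expansion1) big_seq1 mxE mul0r mulr0. Qed.

Lemma eps_d1_gen j k l : eps_d1 j (u k l : A) = (k == l)%:R * (0 +i* weight k 0 j).
Proof. by rewrite (expansion_d1 j (@expansion_gen k l)) big_seq1. Qed.

Lemma eps_d1M j a b : eps_d1 j (a * b : A)
  = eps_d1 j a * counit b + counit a * eps_d1 j b.
Proof.
have [s As] := expansion_exists a; have [s' Bs] := expansion_exists b.
rewrite (expansion_d1 j (expansionM As Bs)) !(expansion_d1 j As, expansion_d1 j Bs).
rewrite (expansion_counit As) (expansion_counit Bs) big_allpairs_dep /=.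
rewrite !mulr_suml -big_split; apply: eq_bigr => x _ /=.
rewrite !mulr_sumr -big_split; apply: eq_bigr => y _ /=.
rewrite mxE; case: x y => [[x1 x2] m] [[y1 y2] l] /=; simpc.
by congr (_ +i* _); ring.
Qed.

(** Frequencies add under multiplication, so termwise this is the expansion of (m_j + l_j)(m_k +
    l_k) into four products. *)
Lemma eps_d2M j k a b : eps_d2 j k (a * b : A)
  = eps_d2 j k a * counit b + counit a * eps_d2 j k b
    + (eps_d1 j a * eps_d1 k b + eps_d1 k a * eps_d1 j b).
Proof.
have [s As] := expansion_exists a; have [s' Bs] := expansion_exists b.
rewrite (expansion_d2 j k (expansionM As Bs)).
rewrite !(expansion_d2 j k As, expansion_d2 j k Bs).
rewrite !(expansion_d1 _ As, expansion_d1 _ Bs).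
rewrite (expansion_counit As) (expansion_counit Bs) big_allpairs_dep /=.
rewrite !mulr_suml -!big_split; apply: eq_bigr => x _ /=.
rewrite !mulr_sumr -!big_split; apply: eq_bigr => y _ /=.
rewrite !mxE; case: x y => [[x1 x2] m] [[y1 y2] l] /=; simpc.
by congr (_ +i* _); ring.
Qed.

Lemma counit_star (a : A) : counit (SUq_star a) = conjc (counit a).
Proof. by rewrite -!eps_theta_at0 eps_theta_star. Qed.

Lemma eps_d1_star j (a : A) : eps_d1 j (SUq_star a) = conjc (eps_d1 j a).
Proof.
have [s As] := expansion_exists a.
rewrite (expansion_d1 j (expansion_star As)) (expansion_d1 j As) big_map rmorph_sum.
by apply: eq_bigr => -[c m] _ /=; rewrite rmorphM /= mxE.
Qed.

Lemma eps_d2_star j k (a : A) : eps_d2 j k (SUq_star a) = conjc (eps_d2 j k a).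
Proof.
have [s As] := expansion_exists a.
rewrite (expansion_d2 j k (expansion_star As)) (expansion_d2 j k As) big_map rmorph_sum.
by apply: eq_bigr => -[c m] _ /=; rewrite !rmorphM /= !mxE.
Qed.

End Characters.

(** * Real positive matrices as hermitian forms *)

Lemma quad_formE (R : comNzRingType) n (S : 'M[R]_n) (x : 'rV[R]_n) :
  (x *m S *m x^T) 0 0 = \sum_l \sum_m S l m * (x 0 l * x 0 m).
Proof.
rewrite mxE exchange_big; apply: eq_bigr => m _ /=.
by rewrite !mxE mulr_suml; apply: eq_bigr => l _; rewrite mulrCA mulrA.
Qed.

(** With a = x + iy the real part is the sum of the quadratic forms at x and y; the imaginary part
    is antisymmetric under exchanging l and m, hence 0 by symmetry of [S]. *)
Lemma psdmx_hermitian_ge0 (R : realType) n (S : 'M[R]_n) (a : 'I_n -> R[i]) :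
  psdmx S -> 0 <= \sum_l \sum_m (S l m)%:C * (conjc (a l) * a m).
Proof.
case=> symS psdS.
pose x := \row_l complex.Re (a l); pose y := \row_l complex.Im (a l).
rewrite (_ : \sum_l _ = ((x *m S *m x^T) 0 0 + (y *m S *m y^T) 0 0)%:C).
  by rewrite ler0c addr_ge0.
pose z l m : R := S l m * (x 0 l * y 0 m).
have zz : \sum_l \sum_m z l m = \sum_l \sum_m z m l.
  by rewrite exchange_big.
rewrite !quad_formE -big_split /=.
(* Zero is inserted as the imaginary part, a double sum minus its transpose, so that the identity
   can be checked term by term. *)
rewrite -[RHS]addr0 -[X in _ + X](subrr ((\sum_l \sum_m z l m)%:C * (0 +i* 1))).
rewrite {2}zz !rmorph_sum !mulr_suml -sumrB -big_split; apply: eq_bigr => l _ /=.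
rewrite -big_split !rmorph_sum !mulr_suml -sumrB -big_split.
apply: eq_bigr => m _ /=.
have -> : z m l = S l m * (x 0 m * y 0 l) by rewrite /z -[S in LHS]symS mxE.
rewrite /z !mxE; case: (a l) (a m) => [b c] [d e] /=; simpc.
by congr (_ +i* _); ring.
Qed.

Lemma conjc_fixed_Re (R : realType) (c : R[i]) : conjc c = c -> (complex.Re c)%:C = c.
Proof. by case: c => a b [ab]; congr (_ +i* _); lra. Qed.

(** * Combinations of the eps'_j and eps''_jk, and their coefficients *)

Section GaussianForm.
Context (R : realType) (q : R) (n : nat).
Local Notation C := (R[i]).
Local Notation A := (SUq q n.+1).
Local Notation qC := (q%:C : C).
Local Notation u := (ugen qC).
Local Notation x j := (u (lift ord0 j) (lift ord0 j) - 1 : A).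

(** The parametrized form with complex coefficients; that they are real is derived later from
    hermiticity. *)
Definition gform (r : 'I_n -> C) (s : 'I_n -> 'I_n -> C) (b : A) : C :=
  \sum_(j < n) r j * eps_d1 j b
  + 2^-1 * \sum_(j < n) \sum_(k < n) s j k * eps_d2 j k b.

Lemma gform_lin r s : scalar (gform r s).
Proof.
apply: add_linear_form; [|apply: scale_linear_form]; apply: sum_linear_form => j.
  exact/scale_linear_form/eps_d1_lin.
by apply: sum_linear_form => k; apply/scale_linear_form/eps_d2_lin.
Qed.

Lemma gform_unit r s : gform r s 1 = 0.
Proof.
rewrite /gform big1 ?add0r => [|j _]; last by rewrite eps_d1_unit mulr0.
by rewrite big1 ?mulr0// => j _; rewrite big1// => k _; rewrite eps_d2_unit mulr0.
Qed.

(** On products from ker eps only the two cross terms of eps''_jk survive; symmetry of [s] makes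
    them equal and absorbs the factor 1/2. *)
Lemma gformM r s (a b : A) : (forall j k, s j k = s k j) ->
  counit a = 0 -> counit b = 0 ->
  gform r s (a * b) = \sum_j \sum_k s j k * (eps_d1 j a * eps_d1 k b).
Proof.
move=> sym a0 b0; rewrite /gform big1 ?add0r => [|j _]; last first.
  by rewrite eps_d1M a0 b0 mulr0 mul0r addr0 mulr0.
under eq_bigr do under eq_bigr do
  rewrite eps_d2M a0 b0 mulr0 mul0r !add0r mulrDr.
under eq_bigr do rewrite big_split.
rewrite big_split /= [X in _ + X]exchange_big /=.
under [X in _ + X]eq_bigr do under eq_bigr do rewrite sym.
set S := \sum_j _; rewrite -[S in S + _]mulr1 -[X in _ + X]mulr1 -mulrDr mulrCA.
by rewrite -[1 + 1]/(2%:R) mulVf ?mulr1 // pnatr_eq0.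
Qed.

Lemma gform_K3 r s (a b c : A) :
  counit a = 0 -> counit b = 0 -> counit c = 0 -> gform r s (a * b * c) = 0.
Proof.
move=> a0 b0 c0; have ab0 : counit (a * b) = 0 by rewrite counitM a0 mul0r.
rewrite /gform big1 ?add0r => [|j _]; last first.
  by rewrite eps_d1M ab0 c0 mulr0 mul0r addr0 mulr0.
rewrite big1 ?mulr0// => j _; rewrite big1// => k _.
have d0 i : eps_d1 i (a * b) = 0.
  by rewrite eps_d1M a0 b0 mulr0 mul0r addr0.
rewrite eps_d2M ab0 c0 2!d0.
move: (eps_d2 j k (a * b)) (eps_d2 j k c) (eps_d1 k c) (eps_d1 j c) (s j k).
by move=> e1 e2 e3 e4 e5; rewrite mulr0 !mul0r !addr0 mulr0.
Qed.

Lemma eps_d1_x j k : eps_d1 k (x j) = 0 +i* (j == k)%:R.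
Proof.
rewrite (linear_formB (eps_d1_lin k)) eps_d1_unit subr0 eps_d1_gen eqxx mul1r.
by rewrite mxE liftK.
Qed.

(** Isolates r_j: the remaining term depends on [s] alone and cancels once [s] is known, so it is
    left unevaluated. *)
Lemma gform_x r s j : gform r s (x j) = r j * (0 +i* 1) + gform (fun=> 0) s (x j).
Proof.
rewrite /gform addrA; congr (_ + _); rewrite [X in _ = _ + X]big1 ?addr0; last first.
  by move=> k _; rewrite mul0r.
rewrite (bigD1 j) //= eps_d1_x eqxx big1 ?addr0// => k kj.
by rewrite eps_d1_x eq_sym (negPf kj) mulr0.
Qed.

Lemma gform_xx r s j k : (forall j k, s j k = s k j) ->
  gform r s (x j * x k) = - s j k.
Proof.
move=> sym; rewrite gformM ?counit_x//.
rewrite (bigD1 j) //= [X in _ + X]big1 ?addr0 => [|l lj]; last first.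
  by rewrite big1// => m _; rewrite eps_d1_x eq_sym (negPf lj) mul0r mulr0.
rewrite (bigD1 k) //= [X in _ + X]big1 ?addr0 => [|l lk]; last first.
  by rewrite !eps_d1_x [k == l]eq_sym (negPf lk) !mulr0.
by rewrite !eps_d1_x !eqxx -expr2 sqr_i mulrN1.
Qed.

(** The values at x_j x_k determine [s]; then the values at x_j determine [r]. *)
Lemma gform_inj r s r' s' :
    (forall j k, s j k = s k j) -> (forall j k, s' j k = s' k j) ->
    gform r s =1 gform r' s' ->
  r =1 r' /\ forall j k, s j k = s' j k.
Proof.
move=> sym sym' E; have Es j k : s j k = s' j k.
  by have := E (x j * x k); rewrite !gform_xx// => /oppr_inj.
split=> // j; have := E (x j).
have -> : s = s' by apply/funext => a; apply/funext => b.
rewrite gform_x [RHS]gform_x => /addIr; apply: mulIf.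
by rewrite eq_complex /= oner_eq0 andbF.
Qed.

Lemma gform_star r s b :
  gform r s (SUq_star b)
  = conjc (gform (fun j => conjc (r j)) (fun j k => conjc (s j k)) b).
Proof.
rewrite /gform rmorphD rmorphM !rmorph_sum; congr (_ + _).
  by apply: eq_bigr => j _; rewrite rmorphM /= conjcK eps_d1_star.
rewrite fmorphV rmorph_nat; congr (_ * _); apply: eq_bigr => j _.
by rewrite rmorph_sum; apply: eq_bigr => k _; rewrite rmorphM /= conjcK eps_d2_star.
Qed.

Lemma Kn3_prod (a b c : A) :
  counit a = 0 -> counit b = 0 -> counit c = 0 -> Kn 3 (a * b * c).
Proof.
move=> a0 b0 c0; exists 1%N, (fun=> 1), (fun _ j => nth 0 [:: a; b; c] j).
split=> [_ [[|[|[|m]]] lt_m3] /=|].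
- exact: a0.
- exact: b0.
- exact: c0.
- by exfalso; move: lt_m3; rewrite !ltnS ltn0.
by rewrite big_ord1 scale1r !big_ord_recl big_ord0 /= mulr1 mulrA.
Qed.

Lemma gaussianP (psi : A -> C) : scalar psi ->
  gaussian psi <-> forall a b c : A,
    counit a = 0 -> counit b = 0 -> counit c = 0 -> psi (a * b * c) = 0.
Proof.
move=> lin; split=> [G a b c a0 b0 c0|G _ [m [c [b [b0 ->]]]]].
  exact/G/Kn3_prod.
rewrite (linear_form_sum lin) big1// => i _.
by rewrite (linear_formZ lin) !big_ord_recl big_ord0 mulr1 mulrA G ?mulr0.
Qed.

(** Test elements of ker eps whose first derivatives eps'_j are the prescribed numbers i c_j. *)
Definition diag_comb (c : 'rV[R]_n) : A := \sum_j (c 0 j)%:C *: x j.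

Lemma counit_comb c : counit (diag_comb c) = 0.
Proof.
rewrite /diag_comb (big_morph _ (@counitD _ qC n.+1) (@counit0 _ qC n.+1)) big1// => j _.
by rewrite counitZ counit_x mulr0.
Qed.

Lemma eps_d1_comb c j : eps_d1 j (diag_comb c) = 0 +i* c 0 j.
Proof.
rewrite (linear_form_sum (eps_d1_lin j)) (bigD1 j) //= big1 ?addr0 => [|k kj].
  by rewrite (linear_formZ (eps_d1_lin j)) eps_d1_x eqxx; simpc.
by rewrite (linear_formZ (eps_d1_lin j)) eps_d1_x (negPf kj) mulr0.
Qed.

Hypothesis q1 : qC != 1.

(** The coefficients are solved from [gform_xx] and [gform_x] so that [psi] and the form agree on
    all x_j x_k and x_j; [gaussian_eq0] kills the difference. *)
Lemma gaussian_gform (psi : A -> C) : scalar psi -> psi 1 = 0 -> gaussian psi ->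
  exists r s, (forall j k, s j k = s k j) /\ psi =1 gform r s.
Proof.
move=> lin psi1 /(gaussianP lin) K3.
pose s j k := - psi (x j * x k).
have sym j k : s j k = s k j.
  by rewrite /s (gaussian_symmetric q1 lin K3).
pose r j := (psi (x j) - gform (fun=> 0) s (x j)) / (0 +i* 1).
exists r, s; split=> // b; apply/eqP; rewrite -subr_eq0; apply/eqP.
have i0 : (0 +i* 1 : C) != 0 by rewrite eq_complex /= oner_eq0 andbF.
apply: (gaussian_eq0 (psi := fun b => psi b - gform r s b) q1).
- move=> c a a'; by rewrite lin gform_lin mulrBr opprD addrACA.
- by move=> a a' c a0 a'0 c0; rewrite K3// gform_K3// subrr.
- by rewrite psi1 gform_unit subrr.
- by move=> j; rewrite gform_x /r divfK// subrK subrr.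
- by move=> j k; rewrite gform_xx// opprK subrr.
Qed.

End GaussianForm.

(** * The bijection between parameters and gaussian generating functionals *)

Theorem theorem3p7 (R : realType) (q : R) (n : nat)
    (hq : 0 < q < 1) (hn : (0 < n)%N) :
  set_bij
    [set r : 'rV[R]_n * 'M[R]_n | psdmx r.2]
    [set psi : SUq q n.+1 -> R[i] | generating_functional psi /\ gaussian psi]
    (fun r b =>
       \sum_(j < n) (r.1 0 j)%:C * eps_d1 j b
       + 2^-1 * \sum_(j < n) \sum_(k < n) (r.2 j k)%:C * eps_d2 j k b).
Proof.
have q1 : (q%:C : R[i]) != 1.
  by rewrite eq_complex /= eqxx andbT lt_eqF//; case/andP: hq.
pose F (r : 'rV[R]_n * 'M[R]_n) : SUq q n.+1 -> R[i] :=
  gform (fun j => (r.1 0 j)%:C) (fun j k => (r.2 j k)%:C).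
have sym (r : 'rV[R]_n * 'M[R]_n) j k : psdmx r.2 -> (r.2 j k)%:C = (r.2 k j)%:C.
  by case=> symr _; rewrite -[r.2 in LHS]symr mxE.
rewrite -[X in set_bij _ _ X]/F; split.
- move=> r /= psdr; have lin := gform_lin (fun j => (r.1 0 j)%:C)
    (fun j k => (r.2 j k)%:C) : scalar (F r).
  split; last by apply/(gaussianP lin) => a b c; exact: gform_K3.
  split=> //; last 1 first.
  (* Positivity: the value at b^* b is the hermitian form of the matrix at the vector of the
     eps'_j(b). *)
  + move=> b b0; have cs : counit (SUq_star b) = 0.
      by rewrite counit_star b0 conjc0.
    rewrite /F (gformM _ (fun j k => sym r j k psdr) cs b0).
    under eq_bigr do under eq_bigr do rewrite eps_d1_star.
    exact: psdmx_hermitian_ge0.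
  + move=> b; rewrite /F gform_star; congr (conjc (gform _ _ b)).
      by apply/funext => j; rewrite conjc_real.
    by apply/funext => j; apply/funext => k; rewrite conjc_real.
  + exact: gform_unit.
- move=> r r' /set_mem /= psdr /set_mem /= psdr' E.
  have [|||Er Es] := @gform_inj R q n (fun j => (r.1 0 j)%:C)
    (fun j k => (r.2 j k)%:C) (fun j => (r'.1 0 j)%:C) (fun j k => (r'.2 j k)%:C).
  + by move=> j k; exact: sym.
  + by move=> j k; exact: sym.
  + by move=> b; rewrite -[LHS]/(F r b) E.
  rewrite [r]surjective_pairing [r']surjective_pairing; congr (_, _).
    by apply/rowP => j; apply: complexI; exact: Er.
  by apply/matrixP => j k; apply: complexI; exact: Es.
- move=> psi /= [[lin star psi1 pos] gauss].
  have [r [s [symm E]]] := gaussian_gform q1 lin psi1 gauss.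
  (* Hermiticity says that conjugating the coefficients gives the same form; by uniqueness they are
     real. *)
  have [|||Er Es] := @gform_inj R q n (fun j => conjc (r j))
    (fun j k => conjc (s j k)) r s.
  + by move=> j k; rewrite symm.
  + exact: symm.
  + by move=> b; have := star b; rewrite !E gform_star => /(can_inj (@conjcK R)).
  have Fpsi : F (\row_j complex.Re (r j), \matrix_(j, k) complex.Re (s j k)) = psi.
    rewrite /F; apply/funext => b; rewrite E; congr (gform _ _ b).
      by apply/funext => j; rewrite mxE conjc_fixed_Re.
    by apply/funext => j; apply/funext => k; rewrite mxE conjc_fixed_Re.
  exists (\row_j complex.Re (r j), \matrix_(j, k) complex.Re (s j k)) => //=.
  split; first by apply/matrixP => j k; rewrite !mxE symm.
  (* Positivity of [psi] is tested on [diag_comb q x]: the factors conj(i x_l) (i x_m) = x_l x_m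
     give the quadratic form at x. *)
  move=> x; rewrite quad_formE -ler0c.
  have c0 := counit_comb q x; have cs : counit (SUq_star (diag_comb q x)) = 0.
    by rewrite counit_star c0 conjc0.
  have := pos _ c0; rewrite E (gformM _ symm cs c0).
  congr (_ <= _); rewrite !rmorph_sum; apply: eq_bigr => l _.
  rewrite rmorph_sum; apply: eq_bigr => m _ /=; rewrite mxE !rmorphM /=.
  by rewrite conjc_fixed_Re// eps_d1_star !eps_d1_comb; simpc.
Qed.
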